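(* Let $G$ be a finite simple connected graph. Then $G$ is closed if and only if $G$ is chordal, claw-free, and narrow.
   Context: A labeling of a finite simple graph $G$ with $n$ vertices is a bijection $V(G)\to[n]=\{1,\dots,n\}$; given a labeling we identify $V(G)=[n]$. A labeling is closed if whenever $\{j,i\},\{i,k\}$ are distinct edges of $G$ with either ($j>i$ and $k>i$) or ($j<i$ and $k<i$), then $\{j,k\}\in E(G)$. A graph is closed if it has a closed labeling. A graph is chordal if every cycle of length at least $4$ has a chord (an edge joining two non-consecutive vertices of the cycle). A graph is claw-free if it has no induced subgraph isomorphic to the star $K_{1,3}$ (one vertex adjacent to three pairwise non-adjacent vertices). For a connected graph, $d(v,w)$ denotes the length of a shortest path between $v$ and $w$, and $\mathrm{diam}(G)=\max\{d(v,w)\mid v,w\in V(G)\}$. A longest shortest path of $G$ is a shortest path connecting two vertices $v,w$ with $d(v,w)=\mathrm{diam}(G)$. A connected graph $G$ is narrow if for every vertex $v$ and every longest shortest path $P$ of $G$, either $v\in V(P)$ or $v$ is adjacent to some vertex of $P$. *)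

(* Defs.v *)
(* A finite simple graph is a symmetric irreflexive adjacency
   relation on a finType of vertices. *)
From mathcomp Require Import all_boot.

Set Implicit Arguments.
Unset Strict Implicit.
Unset Printing Implicit Defensive.

Section Graph.
Variables (T : finType) (e : rel T).

Definition simple_graph : Prop := symmetric e /\ irreflexive e.

Definition connected_graph : Prop := forall x y : T, connect e x y.

(* Labels are taken in {0, ..., n-1} instead of {1, ..., n}; only their order
   matters below. *)
Definition labeling (f : T -> 'I_#|T|) : Prop := bijective f.

(* The edges {j, i} and {i, k} are distinct iff j != k. *)
Definition closed_labeling (f : T -> 'I_#|T|) : Prop :=
  forall i j k : T, e j i -> e i k -> j != k ->
    (f i < f j /\ f i < f k) \/ (f j < f i /\ f k < f i) -> e j k.

Definition closed_graph : Prop :=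
  exists f : T -> 'I_#|T|, labeling f /\ closed_labeling f.

Definition chord (c : seq T) (x y : T) : Prop :=
  [/\ x \in c, y \in c, e x y, y != next c x & x != next c y].

Definition chordal : Prop :=
  forall c : seq T, ucycle e c -> 4 <= size c -> exists x y : T, chord c x y.

(* Adjacency of the star K_{1,3} with centre 0 and leaves 1, 2, 3. *)
Definition claw : rel 'I_4 := [rel i j | (i == ord0) != (j == ord0)].

Definition claw_free : Prop :=
  ~ exists f : 'I_4 -> T, injective f /\ forall i j, e (f i) (f j) = claw i j.

(* The path with vertex sequence x :: p; its length (number of edges) is
   size p. *)
Definition gpath (x y : T) (p : seq T) : bool :=
  [&& path e x p, uniq (x :: p) & last x p == y].

(* The least length of a path from x to y; such a length is always < #|T|, and
   the value is #|T| when there is no path. *)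
Definition dist (x y : T) : nat :=
  find (fun k => [exists p : k.-tuple T, gpath x y p]) (iota 0 #|T|).

Definition diam : nat := \max_(x : T) \max_(y : T) dist x y.

Definition shortest_path (x y : T) (p : seq T) : Prop :=
  gpath x y p /\ size p = dist x y.

Definition longest_shortest_path (x y : T) (p : seq T) : Prop :=
  shortest_path x y p /\ dist x y = diam.

Definition narrow : Prop :=
  forall (v x y : T) (p : seq T), longest_shortest_path x y p ->
    v \in x :: p \/ exists2 w, w \in x :: p & e v w.

Lemma gpath_dist_le x y p : gpath x y p -> dist x y <= size p.
Proof.
move=> gp; have /and3P[_ up _] := gp.
have ltp : size p < #|T|.
  by have := max_card (mem (x :: p)); rewrite (card_uniqP up).
rewrite leqNgt; apply/negP => /(before_find 0); rewrite nth_iota // add0n.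
by move/existsP; apply; exists (in_tuple p).
Qed.

Lemma dist_gpath x y : connect e x y -> exists p, shortest_path x y p.
Proof.
case/connectP => q /shortenP[p pp up _] ->.
have gp : gpath x (last x p) p by apply/and3P; split.
have ltd : dist x (last x p) < #|T|.
  apply: leq_ltn_trans (gpath_dist_le gp) _.
  by have := max_card (mem (x :: p)); rewrite (card_uniqP up).
have : has (fun k => [exists r : k.-tuple T, gpath x (last x p) r])
           (iota 0 #|T|) by rewrite has_find size_iota.
move/(nth_find 0); rewrite nth_iota // add0n => /existsP[r gr].
by exists r; split=> //; rewrite size_tuple.
Qed.

End Graph.

(* Main.v *)
(** Closed implies narrow: minimal walks are monotone for a closed labeling, so
    an edge [a b] makes every vertex labelled in between adjacent to both [a]
    and [b].  A geodesic therefore dominates all vertices labelled between its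
    ends, and a vertex outside this range and not adjacent to the nearer end
    would be too far from the other one.

    Conversely, let [v] and [w] be at distance [diam].  Chordality makes the
    parents of a vertex in the distance layers from [v] a clique,
    claw-freeness does the same for the children of a vertex other than [v],
    and narrowness then makes every layer of index at least 2 a clique.
    Choosing [v] of minimal degree among the vertices farthest from [w] also
    makes the first layer a clique.  Inside a layer the sets of parents and the
    sets of children are chains (no chordless 4-cycle), ordered oppositely (no
    claw); labelling by layers, and inside a layer by increasing sets of
    children and decreasing sets of parents, is closed. *)
Require Import Defs.
From mathcomp Require Import all_boot zify.

Set Implicit Arguments.
Unset Strict Implicit.
Unset Printing Implicit Defensive.

(** * Distances, walks and geodesics in a connected graph *)

Section Distance.
Variables (T : finType) (e : rel T).
Hypothesis e_sym : symmetric e.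
Hypothesis e_conn : connected_graph e.

Local Notation d := (dist e).

Lemma dist_le_walk x p : path e x p -> d x (last x p) <= size p.
Proof.
move=> pp; case/shortenP: (pp) => q pq uq sq.
apply: leq_trans (gpath_dist_le (p := q) _) _; first exact/and3P.
by apply: uniq_leq_size => //; case/andP: uq.
Qed.

Lemma dist_walk x y : exists p, [/\ path e x p, last x p = y & size p = d x y].
Proof.
have [p [/and3P[pp _ /eqP lp] sp]] := dist_gpath (e_conn x y).
by exists p.
Qed.

Lemma rev_walk x p : path e x p ->
  exists q, [/\ path e (last x p) q, last (last x p) q = x & size q = size p].
Proof.
move=> pp; exists (rev (belast x p)); split.
- by rewrite rev_path (eq_path (e' := e)) // => a b; rewrite e_sym.
- by case: p {pp} => //= a p; rewrite rev_cons last_rcons.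
- by rewrite size_rev size_belast.
Qed.

Lemma dist_sym x y : d x y = d y x.
Proof.
suff H a b : d a b <= d b a by apply/eqP; rewrite eqn_leq !H.
have [p [pp <- <-]] := dist_walk b a.
have [q [pq lq <-]] := rev_walk pp.
by rewrite -{2}lq; apply: dist_le_walk.
Qed.

Lemma distxx x : d x x = 0.
Proof. by apply/eqP; rewrite -leqn0; apply: (@dist_le_walk x [::]). Qed.

Lemma dist_eq0 x y : d x y = 0 -> x = y.
Proof. by have [[|a p] [_ lp sp]] := dist_walk x y; rewrite -sp. Qed.

Lemma dist_edge_le x y z : e y z -> d x z <= (d x y).+1.
Proof.
move=> eyz; have [p [pp lp <-]] := dist_walk x y.
have := @dist_le_walk x (rcons p z).
by rewrite rcons_path pp lp eyz last_rcons size_rcons; apply.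
Qed.

Lemma dist_edge_leV x y z : e y z -> d x y <= (d x z).+1.
Proof. by rewrite e_sym; apply: dist_edge_le. Qed.

Lemma dist_triangle x y z : d x z <= d x y + d y z.
Proof.
have [p [pp lp <-]] := dist_walk x y; have [q [pq lq <-]] := dist_walk y z.
have := @dist_le_walk x (p ++ q).
by rewrite cat_path pp lp pq last_cat lp lq size_cat; apply.
Qed.

Lemma dist_parent x y k : d x y = k.+1 -> exists2 z, e z y & d x z = k.
Proof.
have [p [pp lp sp]] := dist_walk x y => dk.
case/lastP: p => [|p u] in pp lp sp *; first by rewrite dk in sp.
move: lp sp pp; rewrite last_rcons size_rcons rcons_path dk => -> [sp] /andP[pp ez].
exists (last x p) => //; have := dist_le_walk pp; have := dist_edge_le x ez.
lia.
Qed.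

Lemma dist_eq1 x y : d x y = 1 -> e x y.
Proof. by case/dist_parent=> z ez /dist_eq0->. Qed.

Lemma dist_le_diam x y : d x y <= diam e.
Proof. by apply: bigmax_sup => //; apply: leq_bigmax. Qed.

Lemma walk_shortest x p : path e x p -> size p = d x (last x p) ->
  shortest_path e x (last x p) p.
Proof.
move=> pp sp; split=> //; apply/and3P; split=> //.
case/shortenP: pp sp => q pq uq sq sp.
have uq' : uniq q by case/andP: uq.
have le_pq : size p <= size q by rewrite sp; exact: dist_le_walk.
apply: (leq_size_uniq uq) => //= u; rewrite !inE => /orP[->//|/sq->].
exact: orbT.
Qed.

Lemma dist_nth_shortest x p i : path e x p -> size p = d x (last x p) ->
  i <= size p ->
  d x (nth x (x :: p) i) = i /\ d (nth x (x :: p) i) (last x p) <= size p - i.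
Proof.
move=> pp sp ip.
have E : nth x (x :: p) i = last x (take i p).
  case: i ip => [|i] ip /=; first by rewrite take0.
  by rewrite (take_nth x) // last_rcons.
have [ptk pdr] : path e x (take i p) /\ path e (last x (take i p)) (drop i p).
  by apply/andP; rewrite -cat_path cat_take_drop.
have L : last (last x (take i p)) (drop i p) = last x p.
  by rewrite -last_cat cat_take_drop.
have := dist_le_walk ptk; have := dist_le_walk pdr.
rewrite L E size_drop size_takel // => h1 h2; split=> //.
have := dist_triangle x (last x (take i p)) (last x p); lia.
Qed.

(** Geodesics from [v] to [a] and from [a] to [w] concatenate to a longest shortest path. It is
    returned as a function [s] of the distance from [v], so that narrowness can be read layer by
    layer. *)
Lemma narrow_geodesic v w a : narrow e -> d v w = diam e -> d v a + d a w = diam e ->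
  exists s : nat -> T, [/\ s (d v a) = a,
    forall i, i <= diam e -> d v (s i) = i /\ d (s i) w <= diam e - i,
    forall i, i < diam e -> e (s i) (s i.+1) &
    forall b, exists2 i, i <= diam e & b = s i \/ e b (s i)].
Proof.
move=> nar vw vaw.
have [p [pp lp sp]] := dist_walk v a; have [q [pq lq sq]] := dist_walk a w.
have ppq : path e v (p ++ q) by rewrite cat_path pp lp.
have lpq : last v (p ++ q) = w by rewrite last_cat lp.
have spq : size (p ++ q) = diam e by rewrite size_cat sp sq.
have spq' : size (p ++ q) = d v (last v (p ++ q)) by rewrite lpq vw.
exists (nth v (v :: (p ++ q))); split.
- rewrite -sp -lp; case: (p) => //= b r.
  by rewrite -cat_cons nth_cat ltnSn nth_last.
- by move=> i; rewrite -spq => /(dist_nth_shortest ppq spq'); rewrite lpq.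
- by move=> i; rewrite -spq => ilt; move/(pathP v): ppq => /(_ i ilt).
move=> b; have := nar b v w (p ++ q).
rewrite -{1}lpq => /(_ (conj (walk_shortest ppq spq') _)).
rewrite lpq => /(_ vw)[bin|[c cin ebc]].
  exists (index b (v :: p ++ q)); last by left; rewrite nth_index.
  by rewrite -spq -ltnS -[(size _).+1]/(size (v :: p ++ q)) index_mem.
exists (index c (v :: p ++ q)); last by right; rewrite nth_index.
by rewrite -spq -ltnS -[(size _).+1]/(size (v :: p ++ q)) index_mem.
Qed.

End Distance.

(** * Shortcuts in cycles of a chordal graph *)

Section Chordal.
Variables (T : finType) (e : rel T).
Hypotheses (e_sym : symmetric e) (e_irr : irreflexive e).
Hypothesis e_chordal : chordal e.

Lemma next_cat_cons2 (l r : seq T) s t :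
  uniq (l ++ s :: t :: r) -> next (l ++ s :: t :: r) s = t.
Proof.
move=> u; rewrite -(next_rot (size l)) // rot_size_cat /= eqxx //.
Qed.

Lemma next_last_cons (m : seq T) s t : uniq (s :: rcons m t) ->
  next (s :: rcons m t) t = s.
Proof.
move=> u; rewrite -(next_rot (size (s :: m))) //.
by rewrite -rcons_cons -cats1 rot_size_cat /= eqxx.
Qed.

(** The ends of the chord are ordered by position in [c]; not being consecutive on the cycle becomes
    [m] and [l ++ r] being nonempty. *)
Lemma chordal_split c : ucycle e c -> 4 <= size c -> exists l s m t r,
  [/\ c = l ++ s :: m ++ t :: r, e s t, m != [::] & l ++ r != [::]].
Proof.
move=> uc c4; have [x [y [xc yc exy nx ny]]] := e_chordal uc c4.
have u : uniq c by case/andP: uc.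
have main l s m t r : c = l ++ s :: m ++ t :: r -> t != next c s -> s != next c t ->
    m != [::] /\ l ++ r != [::].
  move=> ec h1 h2; split; apply/eqP => E.
    by move: h1; rewrite ec E /= next_cat_cons2 ?eqxx //; rewrite ec E in u.
  case: l r E ec => // -[|//] _ /= ec; move: h2.
  by rewrite ec cats1 next_last_cons ?eqxx // -cats1 -ec.
have yx : y != x by apply: contraTneq exy => ->; rewrite e_irr.
case/splitPr: xc main u yc nx ny {uc c4} => l1 l2 main _ yc nx ny.
move: yc; rewrite mem_cat inE (negPf yx) /= => /orP[] yin.
  case/splitPr: yin main nx ny => l r main nx ny.
  have [h1 h2] := main l y r x l2 (esym (catA l (y :: r) (x :: l2))) ny nx.
  by exists l, y, r, x, l2; split=> //; [rewrite -catA | rewrite e_sym].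
case/splitPr: yin main nx ny => l r main nx ny.
have [h1 h2] := main l1 x l y r erefl nx ny.
by exists l1, x, l, y, r.
Qed.

(** The walk, made repetition-free, closes up through [z] to a cycle. No chord can end at [z], so a
    chord shortcuts the walk, and induction on its length applies. *)
Lemma chordal_cap z x p : path e x p -> e z x -> e z (last x p) ->
  (forall u, u \in p -> u != z /\ (e z u -> u = x \/ u = last x p)) ->
  x = last x p \/ e x (last x p).
Proof.
have [n] := ubnP (size p); elim: n p => // n IH p.
move=> sp pp zx; case/shortenP: pp sp => q pq uq sq sp zy int_q.
have szq : size q <= size p by apply: uniq_leq_size => //; case/andP: uq.
have {}int_q u : u \in q -> u != z /\ (e z u -> u = x \/ u = last x q).
  by move/sq/int_q.
case: q => [|b [|b' q]] in pq uq sq szq zy int_q *; first by left.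
  by right; case/andP: pq.
have [q' eq_q'] : exists q', q' = b :: b' :: q by eexists.
have sq2 : 1 < size q' by rewrite eq_q'.
rewrite -eq_q' {b b' q eq_q'} in pq uq sq szq zy int_q *.
have zx' : z != x by apply: contraTneq zx => ->; rewrite e_irr.
have zq : z \notin q' by apply/negP => /int_q[]; rewrite eqxx.
have cyc : ucycle e (z :: x :: q').
  apply/andP; split; last by rewrite cons_uniq inE negb_or zx' zq.
  by rewrite (cycle_path z) /=; move: zy; rewrite e_sym => ->; rewrite zx.
have [|l [s [m [t [r [E est m0 lr0]]]]]] := chordal_split cyc; first by [].
(* As [z] heads the cycle, an empty [l] means a chord from [z] to [t]; nonempty [m] and [r] keep [t]
   away from both ends of the walk. *)
case: l E lr0 => [|z' l] /= [E1 E2] lr0.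
  subst s; exfalso.
  have uE := uq; rewrite E2 in uE.
  have lr : last x q' = last t r by rewrite -[last x q']/(last z (x :: q')) E2 last_cat.
  have [tx ty] : t <> x /\ t <> last x q'.
    case: m m0 E2 uE => // x' m _ [<- _] /= /andP[xn u]; split.
      by move=> tx; move: xn; rewrite mem_cat -tx mem_head orbT.
    rewrite lr => tl; case/lastP: r lr lr0 u {xn} tl => // r y _ _.
    rewrite last_rcons cat_uniq => /and3P[_ _ /= /andP[h _]] ty.
    by rewrite ty mem_rcons mem_head in h.
  have : t \in x :: q' by rewrite E2 mem_cat mem_head orbT.
  rewrite inE => /orP[/eqP//|/int_q[_ /(_ est)]]; tauto.
have [p' [Ep' pp' sp' lp' sub]] : exists p', [/\ x :: p' = l ++ s :: t :: r, path e x p',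
   size p' < size q', last x p' = last x q' & {subset p' <= x :: q'}].
  have sorted_s : sorted e (l ++ s :: m ++ t :: r) by rewrite -E2.
  have sorted' : sorted e (l ++ s :: t :: r).
    have cut a : path e a (m ++ t :: r) -> path e t r.
      by rewrite cat_path => /andP[_ /andP[]].
    move: sorted_s; case: (l) => [|h l'].
      by move/cut => ptr; apply/andP.
    rewrite /= !cat_path => /andP[hl /andP[hs /cut ptr]].
    by apply/andP; split=> //; apply/and3P.
  have sz : size (l ++ s :: t :: r) < size (x :: q').
    by rewrite E2 !size_cat /= size_cat /=; case: (m) m0 => //= *; lia.
  have subs : {subset l ++ s :: t :: r <= x :: q'}.
    move=> u; rewrite E2 !(mem_cat, inE).
    by case/or4P => ->; rewrite ?orbT.
  have la : last x (l ++ s :: t :: r) = last x (x :: q').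
    by rewrite E2 !last_cat /= last_cat.
  have hd : head x (l ++ s :: t :: r) = x.
    by move: E2; case: (l) => [|h l'] /= [->].
  have ne : l ++ s :: t :: r != [::] by case: (l).
  case: (l ++ s :: t :: r) ne sorted' sz subs la hd => [|h p'] //= _.
  move=> pp' sz subs la hd; subst h; exists p'; split => // u up.
  by apply: subs; rewrite inE up orbT.
have := IH p'; rewrite lp'; apply => //; first lia.
move=> u /sub; rewrite inE => /orP[/eqP->|/int_q //].
by rewrite eq_sym; split=> // _; left.
Qed.

Lemma chordal_C4 z x q y : e z x -> e x q -> e q y -> e z y -> z != q -> x != y ->
  ~~ e z q -> e x y.
Proof.
move=> zx xq qy zy zq xy nzq.
have := @chordal_cap z x [:: q; y]; rewrite /= xq qy => /(_ isT zx zy).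
case=> [u||//]; last by move=> E; rewrite E eqxx in xy.
rewrite !inE => /orP[]/eqP->; split; rewrite ?(negPf nzq) //.
- by rewrite eq_sym.
- by apply: contraTneq zy => ->; rewrite e_irr.
- by right.
Qed.

End Chordal.

Lemma claw_free_neighbours (T : finType) (e : rel T) (c x y z : T) :
  symmetric e -> irreflexive e -> claw_free e ->
  e c x -> e c y -> e c z -> x != y -> x != z -> y != z ->
  [|| e x y, e x z | e y z].
Proof.
move=> e_sym e_irr cf cx cy cz xy xz yz; apply: contraT.
rewrite !negb_or => /and3P[nxy nxz nyz]; case: cf.
have ne a b : e a b -> a != b by apply: contraTneq => ->; rewrite e_irr.
exists (fun i : 'I_4 => nth c [:: c; x; y; z] i); split.
  move=> i j /eqP; rewrite nth_uniq ?ltn_ord //; first by move/eqP/val_inj.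
  by rewrite /= !inE !negb_or (ne _ _ cx) (ne _ _ cy) (ne _ _ cz) xy xz yz.
have sE a b : ~~ e a b -> (e a b = false) * (e b a = false).
  by move=> /negPf h; rewrite (e_sym b) h.
by move=> [[|[|[|[|//]]]] hi] [[|[|[|[|//]]]] hj];
  rewrite /= ?e_irr ?cx ?cy ?cz ?(e_sym _ c) ?cx ?cy ?cz ?(sE _ _ nxy) ?(sE _ _ nxz) ?(sE _ _ nyz).
Qed.

(** * Cliques in the distance layers of a chordal, claw-free, narrow graph *)

Section Layers.
Variables (T : finType) (e : rel T).
Hypotheses (e_sym : symmetric e) (e_irr : irreflexive e).
Hypothesis e_conn : connected_graph e.
Hypotheses (e_chordal : chordal e) (e_claw_free : claw_free e) (e_narrow : narrow e).

Local Notation d := (dist e).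

(** Induction on the layer index. A parent common to both ends caps the walk. Otherwise parents [x']
    and [y'] of the ends are adjacent by induction, and [x'] caps the walk from [x] to [y'], which
    makes [y'] a common parent after all. *)
Lemma layer_outer_walk v x p : path e x p -> d v (last x p) = d v x ->
  (forall u, u \in p -> u = last x p \/ d v x < d v u) ->
  x = last x p \/ e x (last x p).
Proof.
move dx : (d v x) => k; elim: k x p dx => [|k IH] x p dx pp dy out.
  by left; rewrite -(dist_eq0 e_conn dy); apply/esym/(dist_eq0 e_conn).
set y := last x p in dy out *.
have [x' ex' dx'] := dist_parent e_conn dx.
have [y' ey' dy'] := dist_parent e_conn dy.
have far u w : d v u = k -> k.+1 < d v w -> ~~ e u w.
  move=> du dw; apply/negP => /(dist_edge_le e_conn v); lia.
have cap w : d v w = k -> e w x -> e w y -> x = y \/ e x y.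
  move=> dw ewx ewy; apply: (chordal_cap e_sym e_irr e_chordal pp ewx ewy).
  move=> u /out[->|dwu]; split.
  - by apply: contraTneq ewy => ->; rewrite e_irr.
  - by right.
  - by apply: contraTneq dwu => ->; rewrite dw; lia.
  - by rewrite (negPf (far _ _ dw dwu)).
have [x'y|nx'y] := boolP (e x' y); first exact: cap x'y.
have [y'x|ny'x] := boolP (e y' x); first exact: cap y'x ey'.
have pp' : path e x (rcons p y') by rewrite rcons_path pp e_sym.
have [x'y'|x'y'] : x' = y' \/ e x' y'.
- have := IH x' (x :: rcons p y') dx'; rewrite /= last_rcons; apply=> //.
    by rewrite ex' pp'.
  move=> u; rewrite inE mem_rcons inE => /or3P[/eqP->|/eqP->|/out[->|]].
  + by right; lia.
  + by left.
  + by right; lia.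
  + by right; lia.
- by rewrite x'y' ey' in nx'y.
have := chordal_cap e_sym e_irr e_chordal pp' ex'; rewrite last_rcons => /(_ x'y').
case.
- move=> u; rewrite mem_rcons inE => /orP[/eqP->|/out[->|du]]; split.
  + by apply: contraTneq x'y' => ->; rewrite e_irr.
  + by right.
  + by apply: contra_eq_neq dx' => <-; rewrite dy; lia.
  + by rewrite (negPf nx'y).
  + by apply: contra_eq_neq dx' => <-; lia.
  + by rewrite (negPf (far _ _ dx' du)).
- by move=> E; rewrite E dy' in dx; lia.
- by rewrite e_sym (negPf ny'x).
Qed.

Lemma parents_adjacent v x y c : d v x = d v y -> d v c = (d v x).+1 ->
  e x c -> e y c -> x != y -> e x y.
Proof.
move=> dxy dc xc yc xy.
have := @layer_outer_walk v x [:: c; y]; rewrite /= xc e_sym yc => /(_ isT (esym dxy)).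
case=> [u||//]; last by move=> E; rewrite E eqxx in xy.
by rewrite !inE => /orP[]/eqP->; [right; lia | left].
Qed.

(** Otherwise [a], [b] and a parent of [p], which exists because [p] is not [v], are the leaves of a
    claw centred at [p]. *)
Lemma children_adjacent v p a b : 0 < d v p -> d v a = (d v p).+1 ->
  d v b = (d v p).+1 -> e p a -> e p b -> a != b -> e a b.
Proof.
move=> dp da db pa pb ab.
have [q eqp dq] := dist_parent e_conn (esym (prednK dp)).
have far u : d v u = (d v p).+1 -> ~~ e q u /\ q != u.
  move=> du; split; first by apply/negP => /(dist_edge_le e_conn v); lia.
  by apply: contraTneq dp => E; rewrite -E in du; lia.
have [[qa qa'] [qb qb']] := (far _ da, far _ db).
have := claw_free_neighbours (c := p) (x := q) (y := a) (z := b) e_sym e_irr e_claw_free.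
rewrite (negPf qa) (negPf qb) /=; apply=> //.
by rewrite e_sym.
Qed.

(** By narrowness [b] has a neighbour on a longest geodesic through [a]: either [a], or a common
    child or parent of [a] and [b]. The bound [1 < d v a] keeps that parent away from [v]. *)
Lemma layer_geodesic_adjacent v w a b : d v w = diam e -> d v a + d a w = diam e ->
  1 < d v a -> d v b = d v a -> a != b -> e a b.
Proof.
move=> vw vaw da db ab.
have [s [sa sd se snar]] := narrow_geodesic e_conn e_narrow vw vaw.
have [i iD [bs|ebs]] := snar b; have [di _] := sd i iD.
  by move: ab; rewrite bs -{1}sa -db bs di eqxx.
have h1 := dist_edge_le e_conn v ebs; have h2 := dist_edge_leV e_sym e_conn v ebs.
have [Ei|[Ei|Ei]] : i = d v a \/ i = (d v a).+1 \/ i = (d v a).-1 by lia.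
- by rewrite e_sym -[X in e _ X]sa -Ei.
- apply: (@parents_adjacent v _ _ (s i)) => //; first lia.
  rewrite -[X in e X _]sa Ei; apply: se; lia.
- apply: (@children_adjacent v (s i)) => //; try lia; last by rewrite e_sym.
  rewrite -[X in e _ X]sa Ei -[X in e _ (s X)](@prednK (d v a)); last lia.
  apply: se; lia.
Qed.

(** Nonadjacent [a] and [b] would lie off every geodesic from [v] to [w]. Given one such geodesic,
    both are then adjacent to its vertex one layer below, hence to each other as its children. *)
Lemma layer_clique v w a b : d v w = diam e -> 1 < d v a -> d v b = d v a ->
  a != b -> e a b.
Proof.
move=> vw da db ab; apply: contraT => nab.
have aD := dist_le_diam e v a.
have geo x y : d v x = d v a -> d v y = d v a -> x != y -> ~~ e x y ->
    d v x + d x w <> diam e.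
  move=> dx dy xy nxy vxw; move: nxy; rewrite (layer_geodesic_adjacent vw vxw) //; lia.
(* In the last layer [a] itself can serve as the far end [w]. *)
have [daD|ltaD] : d v a = diam e \/ d v a < diam e by lia.
  by rewrite (@layer_geodesic_adjacent v a) // ?(distxx e) ?addn0 // in nab.
have [s [_ sd se snar]] : exists s : nat -> T, [/\ s (d v v) = v,
    forall i, i <= diam e -> d v (s i) = i /\ d (s i) w <= diam e - i,
    forall i, i < diam e -> e (s i) (s i.+1) &
    forall b, exists2 i, i <= diam e & b = s i \/ e b (s i)].
  by apply: narrow_geodesic => //; rewrite distxx.
set k := d v a in da db aD ltaD geo *.
(* A neighbour [s k.+1] would put [x] on a geodesic from [v] to [w]. A neighbour [s k] would be the
   centre of a claw with leaves [x], [s k.-1], [s k.+1], of which only the first two can be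
   adjacent. *)
have par x : d v x = k -> d v x + d x w <> diam e -> e x (s k.-1).
  move=> dx ngeo; have tri := dist_triangle e_conn v x w.
  have [i iD [xs|exs]] := snar x; have [di dw] := sd i iD.
    by rewrite -xs in di dw; lia.
  have h1 := dist_edge_le e_conn v exs; have h2 := dist_edge_leV e_sym e_conn v exs.
  have h3 := dist_edge_le e_conn w exs; have h4 := dist_edge_leV e_sym e_conn w exs.
  have [Ei|[Ei|Ei]] : i = k \/ i = k.+1 \/ i = k.-1 by lia.
  - have [d1 _] := sd k.-1 ltac:(lia); have [d2 d2w] := sd k.+1 ltac:(lia).
    have e1 : e (s k) (s k.-1) by rewrite e_sym -{2}(@prednK k) ?se //; lia.
    have e2 : e (s k) (s k.+1) by apply: se.
    have e3 : e (s k) x by rewrite e_sym -Ei.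
    have := claw_free_neighbours e_sym e_irr e_claw_free e3 e1 e2.
    have D1 : x != s k.-1 by apply: contra_eq_neq dx => ->; lia.
    have D2 : x != s k.+1 by apply: contra_eq_neq dx => ->; lia.
    have D3 : s k.-1 != s k.+1 by apply: contra_eq_neq d1 => ->; lia.
    move=> /(_ D1 D2 D3) /or3P[//| h |/(dist_edge_le e_conn v)]; last lia.
    have := dist_edge_le e_conn w h; have := dist_edge_leV e_sym e_conn w h.
    rewrite !(dist_sym e_sym e_conn w); lia.
  - by move: h3 h4; rewrite !(dist_sym e_sym e_conn w); subst i; lia.
  - by rewrite -Ei.
have nba : ~~ e b a by rewrite e_sym.
have ba : b != a by rewrite eq_sym.
have pa := par a erefl (geo a b erefl db ab nab).
have pb := par b db (geo b a db erefl ba nba).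
have [d1 _] := sd k.-1 ltac:(lia).
rewrite (@children_adjacent v (s k.-1)) // in nab; try lia; by rewrite e_sym.
Qed.

(** The closed neighbourhood; containing [x] itself, it can be compared by inclusion for adjacent
    vertices. *)
Definition nbhd x : {set T} := [set u | (u == x) || e x u].

(** Layers are counted from [w] here, so the neighbours of [v] lie in the last layer or the one
    before. Minimality of [v] serves the mixed case. *)
Lemma simplicial_end w v : d w v = diam e ->
  (forall v', d w v' = diam e -> #|nbhd v| <= #|nbhd v'|) ->
  forall x y, e v x -> e v y -> x != y -> e x y.
Proof.
move=> wv vmin.
have [D1|D1] := leqP (diam e) 1.
  move=> x y _ _ xy; apply: (dist_eq1 e_conn).
  have := dist_le_diam e x y; case E: (d x y) => [|[|k]] //; last lia.
  by rewrite (dist_eq0 e_conn E) eqxx in xy.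
have top a b : d w a = diam e -> d w b = diam e -> a != b -> e a b.
  by move=> da db; apply: (layer_clique wv); lia.
have mixed x y : e v x -> e v y -> x != y -> d w x = diam e -> (d w y).+1 = diam e -> e x y.
  move=> vx vy xy dx dy; apply: contraT => nxy.
  (* As [y] is in [nbhd v] but not in [nbhd x], minimality yields a neighbour [z] of [x] not
     adjacent to [v]. Then [v, x, z, y] is a 4-cycle without the diagonal [v z], so [x] and [y] are
     adjacent. *)
  have /subsetPn[z zx zv] : ~~ (nbhd x \subset nbhd v).
    apply/negP => sub; have := vmin x dx; rewrite leqNgt => /negP; apply.
    apply: proper_card; rewrite properE sub; apply/subsetPn; exists y.
      by rewrite inE vy orbT.
    by rewrite inE (negPf nxy) eq_sym (negPf xy).
  move: zv; rewrite inE negb_or => /andP[zv nvz].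
  have xz : e x z.
    by move: zx; rewrite inE => /orP[/eqP zx|//]; rewrite zx vx in nvz.
  have dz : (d w z).+1 = diam e.
    have := dist_edge_leV e_sym e_conn w xz; have := dist_le_diam e w z.
    have [dzD|] := eqVneq (d w z) (diam e); last lia.
    by move: nvz; rewrite e_sym (top z v).
  have zy : e z y.
    have zNy : z != y by apply: contraNneq nxy => <-.
    have := @layer_outer_walk w z [:: x; v; y].
    rewrite /= vy (e_sym z x) (e_sym x v) vx xz => /(_ isT).
    case=> [|u||//]; [lia | | by move=> E; rewrite E eqxx in zNy].
    by rewrite !inE => /or3P[]/eqP->; [right; lia | right; lia | left].
  by rewrite (chordal_C4 e_sym e_irr e_chordal vx xz zy vy) // eq_sym in nxy.
move=> x y vx vy xy.
have := dist_edge_leV e_sym e_conn w vx; have := dist_le_diam e w x.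
have := dist_edge_leV e_sym e_conn w vy; have := dist_le_diam e w y.
have [dxD|nx] := eqVneq (d w x) (diam e); have [dyD|ny] := eqVneq (d w y) (diam e).
- by move=> *; apply: top.
- by move=> *; apply: mixed => //; lia.
- by move=> *; rewrite e_sym; apply: mixed; rewrite 1?eq_sym //; lia.
- move=> *; apply: (@parents_adjacent w x y v) => //; try lia; by rewrite e_sym.
Qed.

(** The root is chosen farthest from [w] with smallest closed neighbourhood: [simplicial_end]
    handles its first layer, [layer_clique] the later ones. *)
Lemma clique_layers_exist (x0 : T) :
  exists v, forall x y, d v x = d v y -> x != y -> e x y.
Proof.
have [w dw] : exists w, \max_(y : T) d w y = diam e.
  rewrite /diam; have := @bigop.eq_bigmax T (fun x => \max_(y : T) d x y).
  by case; [apply/card_gt0P; exists x0 | move=> w ->; exists w].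
have [v0 dv0] : exists v, d w v = diam e.
  rewrite -dw; have := @bigop.eq_bigmax T (d w).
  by case; [apply/card_gt0P; exists x0 | move=> v ->; exists v].
have [|v /eqP dv vmin] := @arg_minnP T v0 (fun v => d w v == diam e) (fun v => #|nbhd v|).
  exact/eqP.
exists v => x y dxy xy.
have vw : d v w = diam e by rewrite dist_sym.
have [dx|dx|dx] := ltngtP (d v x) 1.
- have dx0 : d v x = 0 by lia.
  have dy0 : d v y = 0 by lia.
  by rewrite -(dist_eq0 e_conn dx0) -(dist_eq0 e_conn dy0) eqxx in xy.
- exact: (layer_clique vw).
- apply: (simplicial_end dv) => //; try (apply: dist_eq1 => //; lia).
  by move=> v' /eqP; apply: vmin.
Qed.

End Layers.

(** Vertices are ranked by position in a list sorted by [key]; ties are broken arbitrarily, hence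
    the weak inequality. *)
Lemma labeling_of_key (T : finType) (key : T -> nat) :
  exists2 f : T -> 'I_#|T|, labeling f & forall x y, f x < f y -> key x <= key y.
Proof.
set s := sort (relpre key leq) (enum T).
have us : uniq s by rewrite sort_uniq enum_uniq.
have ms x : x \in s by rewrite mem_sort mem_enum.
have ss : size s = #|T| by rewrite size_sort -cardE.
have lt_s x : index x s < #|T| by rewrite -ss index_mem.
exists (fun x => Ordinal (lt_s x)); last first.
  move=> x y /=; apply: (@sorted_ltn_index _ (relpre key leq) _ s) => //.
  - by move=> b a c; apply: leq_trans.
  - by apply: sort_sorted => a b; apply: leq_total.
apply: inj_card_bij; last by rewrite card_ord.
by move=> x y /(congr1 val) /= /index_inj ->.
Qed.

(** * Labeling a graph whose distance layers are cliques *)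

Section CliqueLayers.
Variables (T : finType) (e : rel T).
Hypotheses (e_sym : symmetric e) (e_irr : irreflexive e).
Hypothesis e_conn : connected_graph e.
Hypotheses (e_chordal : chordal e) (e_claw_free : claw_free e).
Variable v : T.

Local Notation d := (dist e v).

Hypothesis layer_cliques : forall x y, d x = d y -> x != y -> e x y.

Definition children x : {set T} := [set u | e x u & d u == (d x).+1].
Definition parents x : {set T} := [set u | e x u & (d u).+1 == d x].

Lemma adjacent_trichotomy x y :
  e x y -> [\/ d x = d y, y \in children x | y \in parents x].
Proof.
move=> exy; have := dist_edge_le e_conn v exy.
have := dist_edge_leV e_sym e_conn v exy; rewrite !inE exy /=.
have [E|E|E] := ltngtP (d x) (d y); last by constructor 1.
- by move=> *; constructor 2; apply/eqP; lia.
- by move=> *; constructor 3; apply/eqP; lia.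
Qed.

(** Both layers are cliques, so [x, a, b, y] is a 4-cycle with diagonals [x b] and [y a]. This makes
    the child sets within a layer a chain, and likewise the parent sets. *)
Lemma layer_C4 x y a b : d x = d y -> d a = d b -> d x != d a ->
  e x a -> e y b -> e x b || e y a.
Proof.
move=> dxy dab dxa xa yb.
have [<-|xy] := eqVneq x y; first by rewrite xa orbT.
have [<-|ab] := eqVneq a b; first by rewrite xa.
have ne u w : d u != d w -> u != w by apply: contraNneq => ->.
apply: contraT; rewrite negb_or => /andP[nxb nya].
have exy := layer_cliques dxy xy; have eab := layer_cliques dab ab.
have := chordal_C4 e_sym e_irr e_chordal xa eab _ exy.
rewrite (e_sym b) (e_sym a) => /(_ yb) h.
by rewrite h ?ne // -?dab -?dxy // eq_sym in nya.
Qed.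

(** Otherwise [y] is the centre of a claw whose leaves are [x], a child of [y] only and a parent of
    [y] only. *)
Lemma layer_compatible x y : d x = d y -> x != y ->
  ~~ (children y \subset children x) -> parents y \subset parents x.
Proof.
move=> dxy xy /subsetPn[c]; rewrite !inE dxy => /andP[yc /eqP dc].
rewrite dc eqxx andbT => nxc.
apply/subsetP => q; rewrite !inE dxy => /andP[yq /eqP dq].
rewrite dq eqxx andbT; apply: contraT => nxq.
have ne u w : d u != d w -> u != w by apply: contraNneq => ->.
have yx : e y x by rewrite layer_cliques // eq_sym.
have := claw_free_neighbours e_sym e_irr e_claw_free yx yc yq.
rewrite (negPf nxc) (negPf nxq) /= !ne; try lia.
by move=> /(_ isT isT isT) /(dist_edge_leV e_sym e_conn v); lia.
Qed.

(* The subtraction is never truncated. *)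
Definition layer_key x := #|children x| + (#|T| - #|parents x|).

(** If an inclusion failed, the reverse one would be strict by [layer_C4], and [layer_compatible]
    would reverse the other one too, making the key of [x] larger. *)
Lemma layer_key_le x y : d x = d y -> layer_key x <= layer_key y ->
  (children x \subset children y) /\ (parents y \subset parents x).
Proof.
move=> dxy kxy; have [<-|xy] := eqVneq x y; first by [].
have dyx := esym dxy; have yx : y != x by rewrite eq_sym.
have chain_ch : children x \subset children y \/ children y \subset children x.
  have [|/subsetPn[a]] := boolP (children x \subset children y); first by left.
  rewrite !inE => /andP[xa /eqP da]; rewrite -dxy -da eqxx andbT => nya.
  right; apply/subsetP => b; rewrite !inE => /andP[yb /eqP db].
  rewrite db dxy eqxx andbT.
  by have := @layer_C4 x y a b dxy; rewrite (negPf nya) orbF; apply=> //; lia.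
have chain_pa : parents x \subset parents y \/ parents y \subset parents x.
  have [|/subsetPn[a]] := boolP (parents x \subset parents y); first by left.
  rewrite !inE => /andP[xa /eqP da]; rewrite da dxy eqxx andbT => nya.
  right; apply/subsetP => b; rewrite !inE => /andP[yb /eqP db].
  rewrite db dxy eqxx andbT.
  by have := @layer_C4 x y a b dxy; rewrite (negPf nya) orbF; apply=> //; lia.
have px := max_card (parents x); have py := max_card (parents y).
have [cxy|ncxy] := boolP (children x \subset children y);
  have [pyx|npyx] := boolP (parents y \subset parents x) => //; exfalso.
- have pp : parents x \proper parents y.
    by rewrite properE npyx andbT; case: chain_pa npyx => // ->.
  have cyx : children y \subset children x.
    by apply: contraNT npyx; apply: layer_compatible.
  have := proper_card pp; have := subset_leq_card cyx.
  by move: kxy; rewrite /layer_key; lia.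
- have cp : children y \proper children x.
    by rewrite properE ncxy andbT; case: chain_ch ncxy => // ->.
  have pxy := layer_compatible dyx yx ncxy.
  have := proper_card cp; have := subset_leq_card pxy.
  by move: kxy; rewrite /layer_key; lia.
- have pxy := layer_compatible dyx yx ncxy.
  have cp : children y \proper children x.
    by rewrite properE ncxy andbT; case: chain_ch ncxy => // ->.
  have := proper_card cp; have := subset_leq_card pxy.
  by move: kxy; rewrite /layer_key; lia.
Qed.

Lemma clique_layers_closed : closed_graph e.
Proof.
(* The multiplier exceeds every [layer_key], so keys compare lexicographically, distance first. *)
pose key x := d x * (2 * #|T|).+1 + layer_key x.
have kb x : layer_key x <= 2 * #|T|.
  by have := max_card (children x); rewrite /layer_key; lia.
have [f bf fkey] := labeling_of_key key.
have fle x y : f x < f y -> d x <= d y /\ (d x = d y -> layer_key x <= layer_key y).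
  move=> /fkey; rewrite /key; have := kb x; have := kb y => h1 h2 h3.
  by split; [nia | move=> E; rewrite E in h3; lia].
exists f; split=> // i j k ji ik jk fijk.
have ij : e i j by rewrite e_sym.
have [E|djk] := eqVneq (d j) (d k); first exact: layer_cliques.
have h1 := dist_edge_le e_conn v ij; have h2 := dist_edge_leV e_sym e_conn v ij.
have h3 := dist_edge_le e_conn v ik; have h4 := dist_edge_leV e_sym e_conn v ik.
(* In [up] and [down], [a] shares the layer of [i] and [b] is a child, respectively a parent, of
   [i]; the inclusion of sets makes it one of [a] as well. *)
have up a b : e i a -> e i b -> f i < f a -> d i = d a -> d b = (d i).+1 -> e a b.
  move=> ia ib /fle[_ /[swap] dia /(_ dia) /(layer_key_le dia)[/subsetP/(_ b)]].
  by rewrite !inE ib => sub _ db; move: sub; rewrite db eqxx => /(_ isT) /andP[].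
have down a b : e i a -> e i b -> f a < f i -> d i = d a -> (d b).+1 = d i -> e a b.
  move=> ia ib /fle[_ /[swap] /esym dia /(_ dia) /(layer_key_le dia)[_ /subsetP/(_ b)]].
  by rewrite !inE ib => sub db; move: sub; rewrite db eqxx => /(_ isT) /andP[].
case: fijk => -[fj fk].
- have [dj _] := fle _ _ fj; have [dk _] := fle _ _ fk.
  have [E|E] : d i = d j \/ d i = d k by lia.
  + by apply: up => //; lia.
  + by rewrite e_sym; apply: up => //; lia.
- have [dj _] := fle _ _ fj; have [dk _] := fle _ _ fk.
  have [E|E] : d i = d j \/ d i = d k by lia.
  + by apply: down => //; lia.
  + by rewrite e_sym; apply: down => //; lia.
Qed.

End CliqueLayers.

Lemma closed_graph_of_narrow (T : finType) (e : rel T) :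
  simple_graph e -> connected_graph e ->
  chordal e -> claw_free e -> narrow e -> closed_graph e.
Proof.
move=> [e_sym e_irr] e_conn ch cf nar.
have [x0 _|T0] := pickP (xpredT : pred T).
  have [v hv] := clique_layers_exist e_sym e_irr e_conn ch cf nar x0.
  exact: clique_layers_closed hv.
exists enum_rank; split; first exact: enum_rank_bij.
by move=> i; have := T0 i.
Qed.

(** * Chordality, claw-freeness and narrowness from a closed labeling *)

Section ClosedOrder.
Variables (T : finType) (e : rel T).
Hypotheses (e_sym : symmetric e) (e_irr : irreflexive e).

Definition closed_order (g : T -> nat) := injective g /\
  forall i j k, e i j -> e i k -> j != k ->
    (g i < g j /\ g i < g k) \/ (g j < g i /\ g k < g i) -> e j k.

Lemma closed_order_rev g :
  closed_order g -> exists2 g', closed_order g' & forall x y, (g' x < g' y) = (g y < g x).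
Proof.
case=> injg cg; pose M := \max_x g x.
have gM x : g x <= M by apply: leq_bigmax.
have E x y : (M - g x < M - g y) = (g y < g x) by have := gM x; have := gM y; lia.
exists (fun x => M - g x) => //; split.
  by move=> x y h; apply: injg; have := gM x; have := gM y; lia.
by move=> i j k ij ik jk; rewrite !E => h; apply: (cg i) => //; tauto.
Qed.

Lemma closed_order_gt g x y : closed_order g -> e x y -> ~~ (g x < g y) -> g y < g x.
Proof.
move=> [injg _] exy; rewrite -leqNgt leq_eqVlt => /orP[/eqP/injg yx|//].
by rewrite yx e_irr in exy.
Qed.

Definition minimal_walk x p :=
  path e x p /\ forall q, path e x q -> last x q = last x p -> size p <= size q.

Lemma minimal_walk_behead x y p : minimal_walk x (y :: p) -> minimal_walk y p.
Proof.
move=> [/andP[xy pp] min]; split=> // q pq lq.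
by have := min (y :: q); rewrite /= xy pq lq; apply.
Qed.

(** At a descent from [y] to [z], both neighbours of [y] on the walk are labelled below [y]; they
    are equal or adjacent, and the walk can be shortened. *)
Lemma minimal_walk_increasing g x y p : closed_order g -> minimal_walk x (y :: p) ->
  g x < g y -> path (relpre g ltn) x (y :: p).
Proof.
move=> cg; elim: p x y => [|z p IH] x y mw xy; first by rewrite /= xy.
have mw' := minimal_walk_behead mw.
have [pw min] := mw.
have /and3P[exy eyz pz] : [&& e x y, e y z & path e z p] := pw.
rewrite -[path _ _ _]/((g x < g y) && path _ y (z :: p)) xy /=; apply: (IH y z) => //.
apply: contraT => /(closed_order_gt cg eyz) zy; exfalso.
have [xz|xz] := eqVneq x z.
  by rewrite -xz in pz; have := min p pz; rewrite /= xz => /(_ erefl); lia.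
have exz : e x z by case: cg => _ /(_ y); apply=> //; [rewrite e_sym | right].
have pxz : path e x (z :: p) by rewrite /= exz.
by have := min _ pxz erefl; rewrite /=; lia.
Qed.

Lemma increasing_walk_last (g : T -> nat) x p : path (relpre g ltn) x p -> g x <= g (last x p).
Proof.
elim: p x => //= y p IH x /andP[xy /IH]; exact: leq_trans (ltnW xy).
Qed.

Hypothesis e_conn : connected_graph e.

(** A shortest walk starting downwards would, by the reversed order, keep descending and end below
    [x]. *)
Lemma increasing_walk_exists g x y : closed_order g -> g x < g y ->
  exists p, [/\ path e x p, path (relpre g ltn) x p & last x p = y].
Proof.
move=> cg xy; have [p [pp lp sp]] := dist_walk e_conn x y.
have min q : path e x q -> last x q = last x p -> size p <= size q.
  by move=> pq lq; rewrite sp -lp -lq; apply: dist_le_walk.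
exists p; split=> //; case: p => // z p in pp lp sp min *.
apply: minimal_walk_increasing => //.
apply: contraT => nxz; have exz : e x z by case/andP: pp.
have [g' cg' rev_g'] := closed_order_rev cg.
have zx := closed_order_gt cg exz nxz; rewrite -rev_g' in zx.
have := increasing_walk_last (minimal_walk_increasing cg' (conj pp min) zx).
by rewrite lp leqNgt rev_g' xy.
Qed.

(** The edge is pushed along an increasing walk from [a] to [c]: the next vertex [u] and [b] are
    both neighbours of [a] above it, so [u b] is an edge. Once [c b] is one, closedness at [b] gives
    [a c]. *)
Lemma umbrella g a b c : closed_order g -> e a b -> g a < g c -> g c < g b ->
  e a c /\ e c b.
Proof.
move=> cg eab ac cb; have [injg cl] := cg.
have ne x y : g x < g y -> x != y by apply: contraTneq => ->; rewrite ltnn.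
suff ecb : e c b.
  by split=> //; apply: (cl b); rewrite 1?e_sym // ?ne //; right; split=> //; apply: ltn_trans cb.
have [p [pp ip lp]] := increasing_walk_exists cg ac.
elim: p a eab {ac} pp ip lp => [|u p IH] a eab /=; first by move=> _ _ <-.
move=> /andP[au pp] /andP[gau ip] lp; apply: (IH u) => //.
have ub : g u < g b by apply: leq_ltn_trans cb; rewrite -lp; apply: increasing_walk_last.
by apply: (cl a) => //; [exact: ne | left; split=> //; apply: ltn_trans ub].
Qed.

(** Where the walk first passes above [x], [umbrella] joins [x] to the upper end of that edge, and
    the rest of the walk is kept. *)
Lemma walk_from_between g u x p : closed_order g -> path e u p ->
  g u <= g x -> g x <= g (last u p) ->
  exists q, [/\ path e x q, last x q = last u p & size q <= size p].
Proof.
move=> cg; have [injg _] := cg; elim: p u => [|w p IH] u /=.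
  by move=> _ ux xu; exists [::]; split=> //=; apply: injg; lia.
move=> /andP[uw pp] ux xl; have [wx|xw] := leqP (g w) (g x).
  by have [q [? ? ?]] := IH w pp wx xl; exists q; split=> //; apply: leqW.
move: ux; rewrite leq_eqVlt => /orP[/eqP/injg<-|ux].
  by exists (w :: p); rewrite /= uw.
by have [_ xw'] := umbrella cg uw ux xw; exists (w :: p); rewrite /= xw'.
Qed.

Lemma walk_dominates_between g u x p : closed_order g -> path e u p ->
  g u <= g x -> g x <= g (last u p) ->
  x \in u :: p \/ exists2 w, w \in u :: p & e x w.
Proof.
move=> cg; have [injg _] := cg; elim: p u => [|w p IH] u /=.
  by move=> _ ux xu; left; rewrite inE; apply/eqP/injg; lia.
move=> /andP[uw pp] ux xl; have [wx|xw] := leqP (g w) (g x).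
  have [xin|[z zin xz]] := IH w pp wx xl; first by left; rewrite inE xin orbT.
  by right; exists z; rewrite // inE zin orbT.
move: ux; rewrite leq_eqVlt => /orP[/eqP/injg->|ux]; first by left; rewrite mem_head.
have [ux' _] := umbrella cg uw ux xw; right; exists u; first exact: mem_head.
by rewrite e_sym.
Qed.

(** If the first step of a shortest walk from [v] to [y] overshoots [x], [umbrella] gives the edge.
    Otherwise [walk_from_between] would lead from [x] to [y] in fewer than [dist e v y] steps. *)
Lemma beyond_end_adjacent g v x y : closed_order g -> g v < g x -> g x <= g y ->
  dist e v y <= dist e x y -> e x v.
Proof.
move=> cg vx xy; have [[|u p] [pp lp <-]] := dist_walk e_conn v y.
  by move: (leq_trans vx xy); rewrite -lp /= ltnn.
move: pp lp => /= /andP[vu pp] lp dxy.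
have [ux|xu] := leqP (g u) (g x); last by rewrite e_sym; case: (umbrella cg vu vx xu).
have xl : g x <= g (last u p) by rewrite lp.
have [q [pq lq sq]] := walk_from_between cg pp ux xl.
by have := dist_le_walk pq; rewrite lq lp; lia.
Qed.

Lemma closed_order_narrow g : closed_order g -> narrow e.
Proof.
move=> cg v x y p [[/and3P[pp _ /eqP lp] sp] dD].
wlog xy : g cg / g x <= g y.
  move=> W; have [|/ltnW yx] := leqP (g x) (g y); first exact: W.
  have [g' cg' rev_g'] := closed_order_rev cg; apply: (W g') => //.
  by rewrite leqNgt rev_g' -leqNgt.
have dsym := dist_sym e_sym e_conn.
(* For [v] outside the range of the ends, the distance hypothesis of [beyond_end_adjacent] holds
   because the ends are at distance [diam e]. *)
have [xv|vx] := leqP (g x) (g v); last first.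
  right; exists x; first exact: mem_head.
  rewrite e_sym; apply: (beyond_end_adjacent cg vx xy).
  by rewrite dD; apply: dist_le_diam.
have [vy|yv] := leqP (g v) (g y).
  by apply: (walk_dominates_between cg pp) => //; rewrite lp.
right; exists y; first by rewrite -lp mem_last.
have [g' cg' rev_g'] := closed_order_rev cg.
rewrite e_sym; apply: (@beyond_end_adjacent g' v y x) => //.
- by rewrite rev_g'.
- by rewrite leqNgt rev_g' -leqNgt.
- by rewrite (dsym y) dD; apply: dist_le_diam.
Qed.

(** Two of the three leaves lie on the same side of the centre, and closedness joins them. *)
Lemma closed_order_claw_free g : closed_order g -> claw_free e.
Proof.
move=> cg [f [injf fE]]; have [_ cl] := cg.
pose o (k : nat) : 'I_4 := inord k.
have ok k : k < 4 -> o k = k :> nat by move=> k4; rewrite inordK.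
have eE i j : i < 4 -> j < 4 -> e (f (o i)) (f (o j)) = ((i == 0) != (j == 0)).
  by move=> i4 j4; rewrite fE -{2}(ok i) // -{2}(ok j).
have ne i j : i < 4 -> j < 4 -> i != j -> f (o i) != f (o j).
  by move=> i4 j4; apply: contra_neq => /injf /(congr1 val); rewrite /= !ok.
pose side k := g (f (o 0)) < g (f (o k)).
have sep i j : i < 4 -> j < 4 -> 0 < i -> 0 < j -> i != j -> side i != side j.
  move=> i4 j4 i0 j0 ij; apply/eqP => sij.
  have e0 k : k < 4 -> 0 < k -> e (f (o 0)) (f (o k)).
    by move=> k4 k0; rewrite eE // eqxx eqn0Ngt k0.
  have : e (f (o i)) (f (o j)).
    apply: (cl (f (o 0))); rewrite ?e0 ?ne //.
    have [si|nsi] := boolP (side i); first by left; rewrite -/(side j) -sij.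
    right; split; apply: (closed_order_gt cg); rewrite ?e0 //.
    by rewrite -/(side j) -sij.
  by rewrite eE // !eqn0Ngt i0 j0.
have := sep 1 2 isT isT isT isT isT; have := sep 1 3 isT isT isT isT isT.
have := sep 2 3 isT isT isT isT isT.
by case: (side 1); case: (side 2); case: (side 3).
Qed.

(** The chord joins the two cycle neighbours of the vertex with the largest label. *)
Lemma closed_order_chordal g : closed_order g -> chordal e.
Proof.
move=> cg c /andP[cc uc] c4; have [injg cl] := cg.
have [x xc xmax] : exists2 x, x \in c & forall y, y \in c -> g y <= g x.
  case: c c4 {cc uc} => // a c _.
  have [x xc xmax] := @arg_maxnP T a (mem (a :: c)) g (mem_head a c).
  by exists x.
have [i s cs] := rot_to xc.
have cyc : cycle e (x :: s) by rewrite -cs rot_cycle.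
have us : uniq (x :: s) by rewrite -cs rot_uniq.
have ss : 4 <= size (x :: s) by rewrite -cs size_rot.
have mc y : y \in x :: s -> y \in c by rewrite -cs mem_rot.
have nx y : next c y = next (x :: s) y by rewrite -cs next_rot.
case: s => // a s in cyc us ss mc nx {cs} *.
case/lastP: s => // s b in cyc us ss mc nx *.
have ain : a \in x :: a :: rcons s b by rewrite !inE eqxx orbT.
have bin : b \in x :: a :: rcons s b by rewrite !inE mem_rcons mem_head !orbT.
have [xa xb] : e x a /\ e x b.
  move: cyc; rewrite /= rcons_path last_rcons => /and3P[-> _ bx].
  by rewrite e_sym.
have := us.
rewrite /= inE !mem_rcons !inE rcons_uniq !negb_or.
move=> /and4P[/and3P[xNa xNb _] /andP[aNb aNs] bNs _].
have lt y : y \in x :: a :: rcons s b -> x != y -> g y < g x.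
  move=> yin xy; rewrite ltn_neqAle xmax ?mc // andbT.
  by apply: contra_neq xy => /injg.
have eab : e a b by apply: (cl x) => //; right; rewrite !lt.
exists a, b; split=> //; try exact: mc; rewrite nx.
(* Length at least 4 puts a vertex [h] right after [a] and distinct from [b]. *)
- case: s us ss bNs {mc nx ain bin cyc lt aNs} => // h s us _.
  have := @next_cat_cons2 T [:: x] (rcons s b) a h; rewrite /= => -> //.
  by rewrite inE negb_or => /andP[].
- rewrite -rcons_cons (@next_last_cons T (a :: s) x b) //.
  by rewrite eq_sym.
Qed.

End ClosedOrder.

Theorem theorem1p4 (T : finType) (e : rel T)
    (e_simple : simple_graph e) (e_connected : connected_graph e) :
  closed_graph e <-> [/\ chordal e, claw_free e & narrow e].
Proof.
split; last by case=> *; apply: closed_graph_of_narrow.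
case=> f [bij_f cl_f]; have [e_sym e_irr] := e_simple.
have cg : closed_order e (fun x => f x : nat).
  split; first by move=> x y /val_inj; apply: bij_inj.
  by move=> i j k ij; apply: cl_f; rewrite e_sym.
split.
- exact: closed_order_chordal cg.
- exact: closed_order_claw_free cg.
- exact: closed_order_narrow cg.
Qed.
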